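(* Let $v_1,\dots,v_m$ be finitely many unit vectors in $\mathbb{R}^n$ and let $\alpha=(u_1,u_2,\dots)$ be any sequence with each $u_i\in\{v_1,\dots,v_m\}$. Then for every nonempty compact convex set $K\subseteq\mathbb{R}^n$, the limit $L=\mathrm{s}_\alpha K=\lim_{i\to\infty}\mathrm{s}_{u_i}\cdots\mathrm{s}_{u_1}K$ exists in the Hausdorff metric, and $L$ is symmetric under reflection across the hyperplane $v_j^\perp$ for each $v_j$ that occurs infinitely often in $\alpha$.
   Context: For a nonempty compact convex $K\subseteq\mathbb{R}^n$ and a unit vector $u$, the Steiner symmetrization $\mathrm{s}_uK$ is defined as follows: for each point $x$ of the orthogonal projection $\pi_uK$ of $K$ onto $u^\perp$, let $\ell_x(K)$ be the length of the segment $K\cap(x+\mathbb{R}u)$; then $\mathrm{s}_uK=\{x+tu:\ x\in\pi_uK,\ |t|\le \tfrac12\ell_x(K)\}$. *)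

(* Defs.v *)
From Stdlib Require Import Reals Lra.
Open Scope R_scope.

(* Points of R^n are represented as functions nat -> R; a point lies in R^n
   when all coordinates of index >= n vanish. Sets are predicates. *)
Definition pt := nat -> R.
Definition set_pt := pt -> Prop.

Definition inRn (n : nat) (x : pt) : Prop := forall i, (n <= i)%nat -> x i = 0.

Fixpoint dot (n : nat) (x y : pt) : R :=
  match n with
  | O => 0
  | S k => dot k x y + x k * y k
  end.

Definition normRn (n : nat) (x : pt) : R := sqrt (dot n x x).
Definition padd (x y : pt) : pt := fun i => x i + y i.
Definition psub (x y : pt) : pt := fun i => x i - y i.
Definition pscal (t : R) (x : pt) : pt := fun i => t * x i.
Definition distRn (n : nat) (x y : pt) : R := normRn n (psub x y).

Definition unit_vec (n : nat) (u : pt) : Prop := inRn n u /\ normRn n u = 1.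

Definition subset_Rn (n : nat) (K : set_pt) : Prop := forall x, K x -> inRn n x.
Definition nonempty (K : set_pt) : Prop := exists x, K x.
Definition convex (K : set_pt) : Prop :=
  forall x y t, K x -> K y -> 0 <= t <= 1 ->
    K (padd (pscal (1 - t) x) (pscal t y)).

Definition seq_conv (n : nat) (f : nat -> pt) (x : pt) : Prop :=
  forall eps, eps > 0 -> exists N, forall k, (N <= k)%nat -> distRn n (f k) x < eps.

(* compactness (sequential compactness, equivalent to compactness in R^n) *)
Definition compact_Rn (n : nat) (K : set_pt) : Prop :=
  subset_Rn n K /\
  forall f : nat -> pt, (forall k, K (f k)) ->
    exists (phi : nat -> nat) (x : pt),
      (forall k, (phi k < phi (S k))%nat) /\ K x /\ seq_conv n (fun k => f (phi k)) x.

Definition convex_body (n : nat) (K : set_pt) : Prop :=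
  nonempty K /\ compact_Rn n K /\ convex K.

Definition proj (n : nat) (u x : pt) : pt := psub x (pscal (dot n x u) u).

(* Steiner symmetrization s_u K: the points x + t u with x in pi_u K and
   |t| <= l_x(K)/2, where l_x(K) is the length of the segment K ∩ (x + R u),
   i.e. (for K compact_Rn) max - min of {s | x + s u ∈ K}; the inequality
   |t| <= l_x(K)/2 is written as the existence of a, b with x + a u, x + b u
   in K and 2|t| <= b - a. *)
Definition steiner (n : nat) (u : pt) (K : set_pt) : set_pt :=
  fun y => exists (x : pt) (t : R),
    y = padd x (pscal t u) /\
    (exists k, K k /\ x = proj n u k) /\
    (exists a b, K (padd x (pscal a u)) /\ K (padd x (pscal b u)) /\
                 2 * Rabs t <= b - a).

Fixpoint iter_steiner (n : nat) (alpha : nat -> pt) (K : set_pt) (i : nat) : set_pt :=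
  match i with
  | O => K
  | S k => steiner n (alpha k) (iter_steiner n alpha K k)
  end.

Definition hausdorff_conv (n : nat) (Ks : nat -> set_pt) (L : set_pt) : Prop :=
  forall eps, eps > 0 -> exists N, forall i, (N <= i)%nat ->
    (forall x, Ks i x -> exists y, L y /\ distRn n x y <= eps) /\
    (forall y, L y -> exists x, Ks i x /\ distRn n x y <= eps).

Definition reflect_hyp (n : nat) (v x : pt) : pt := psub x (pscal (2 * dot n x v) v).

Definition symmetric_wrt (n : nat) (v : pt) (L : set_pt) : Prop :=
  forall x, L x <-> L (reflect_hyp n v x).

(* Main.v *)
Require Import Defs.
From Stdlib Require Import Reals Lra Lia List Arith.
From Stdlib Require Import Classical ClassicalEpsilon FunctionalExtensionality.
Open Scope R_scope.

(** Write [h_i] for the support function of the [i]-th iterate and [R_u] for the reflection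
    across the hyperplane orthogonal to [u].  Since [s_u K] lies in [(K + R_u K) / 2], we have
    [h_(i+1) <= (h_i + h_i o R_u) / 2] with [u = u_(i+1)].

    For a finite net [X] of the unit ball and a constant [c] making [h + c] positive, let
    [N(h)] be the supremum over all linear isometries [g] of the sum of [(h (g x) + c)^2] over
    [x] in [X].  By convexity of the square [N(h_i)] decreases; by strict convexity a small
    decrease forces [h_i] to be almost invariant under [R_u]; by strict monotonicity, if [h_i]
    is nearly below some [f] with [N(f) <= N(h_i)], then [h_i] is close to [f].

    Let [f] be a uniform cluster point of [(h_i)], so that [N(f) <= N(h_i)] for every [i].  As
    long as only directions whose reflections fix [f] are used, an estimate [h_i <= f + d]
    persists.  If a recurrent direction did not fix [f], start from an [h_i] near [f] and stop
    at the first direction [u] not fixing [f]: there [h_i] is still near [f] and almost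
    [R_u]-invariant.  Some such [u] occurs for arbitrarily small errors, so [R_u] fixes [f]
    after all, a contradiction.  Thus eventually all directions used fix [f], the estimate
    [h_i <= f + d] persists forever, and [h_i] converges to [f] uniformly on the ball. *)

(** * Euclidean geometry, support functions and symmetrization *)

Lemma dot_comm n x y : dot n x y = dot n y x.
Proof. induction n as [|n IH]; simpl; [reflexivity | rewrite IH; ring]. Qed.

Lemma dot_padd n x y z : dot n (padd x y) z = dot n x z + dot n y z.
Proof. induction n as [|n IH]; simpl; [ring | rewrite IH; unfold padd; ring]. Qed.

Lemma dot_psub n x y z : dot n (psub x y) z = dot n x z - dot n y z.
Proof. induction n as [|n IH]; simpl; [ring | rewrite IH; unfold psub; ring]. Qed.

Lemma dot_pscal n t x z : dot n (pscal t x) z = t * dot n x z.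
Proof. induction n as [|n IH]; simpl; [ring | rewrite IH; unfold pscal; ring]. Qed.

Lemma dot_padd_r n x y z : dot n z (padd x y) = dot n z x + dot n z y.
Proof. rewrite dot_comm, dot_padd, !(dot_comm n z); ring. Qed.

Lemma dot_psub_r n x y z : dot n z (psub x y) = dot n z x - dot n z y.
Proof. rewrite dot_comm, dot_psub, !(dot_comm n z); ring. Qed.

Lemma dot_pscal_r n t x z : dot n z (pscal t x) = t * dot n z x.
Proof. rewrite dot_comm, dot_pscal, (dot_comm n z); ring. Qed.

Ltac dot_expand :=
  repeat rewrite ?dot_padd, ?dot_psub, ?dot_pscal, ?dot_padd_r, ?dot_psub_r,
    ?dot_pscal_r.

Lemma dot_self_ge0 n x : 0 <= dot n x x.
Proof. induction n as [|n IH]; simpl; nra. Qed.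

Lemma norm_ge0 n x : 0 <= normRn n x.
Proof. apply sqrt_pos. Qed.

Lemma norm_sqr n x : normRn n x * normRn n x = dot n x x.
Proof. apply sqrt_sqrt, dot_self_ge0. Qed.

Lemma norm_le n x r : 0 <= r -> dot n x x <= r * r -> normRn n x <= r.
Proof.
  intros Hr H; unfold normRn; rewrite <- (sqrt_square r Hr); now apply sqrt_le_1_alt.
Qed.

Lemma cauchy_schwarz_sqr n x y : dot n x y * dot n x y <= dot n x x * dot n y y.
Proof.
  pose proof (dot_self_ge0 n x) as HX; pose proof (dot_self_ge0 n y) as HY.
  assert (Q : forall t, 0 <= dot n x x + 2 * t * dot n x y + t * t * dot n y y).
  { intro t; pose proof (dot_self_ge0 n (padd x (pscal t y))) as H; revert H.
    dot_expand; rewrite (dot_comm n y x); lra. }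
  destruct HY as [HY | HY].
  (* This [t] minimizes the quadratic in [Q]. *)
  - specialize (Q (- dot n x y / dot n y y)).
    replace (dot n x x + 2 * (- dot n x y / dot n y y) * dot n x y
      + - dot n x y / dot n y y * (- dot n x y / dot n y y) * dot n y y)
      with ((dot n x x * dot n y y - dot n x y * dot n x y) / dot n y y) in Q
      by (field; lra).
    apply Rmult_le_compat_r with (r := dot n y y) in Q; [|lra].
    unfold Rdiv in Q; rewrite Rmult_assoc, Rinv_l in Q; lra.
  - rewrite <- HY in *.
    destruct (Req_dec (dot n x y) 0) as [E | E]; [rewrite E; lra|].
    (* With [dot n y y = 0] the quadratic degenerates to an affine function of [t]; this [t] gives
       it the value [-1]. *)
    specialize (Q (- (dot n x x + 1) / (2 * dot n x y))).
    replace (dot n x x + 2 * (- (dot n x x + 1) / (2 * dot n x y)) * dot n x y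
      + - (dot n x x + 1) / (2 * dot n x y) * (- (dot n x x + 1) / (2 * dot n x y)) * 0)
      with (- 1) in Q by (field; lra).
    lra.
Qed.

Lemma cauchy_schwarz n x y : Rabs (dot n x y) <= normRn n x * normRn n y.
Proof.
  unfold normRn; rewrite <- sqrt_mult_alt by apply dot_self_ge0.
  rewrite <- sqrt_Rsqr_abs; apply sqrt_le_1_alt, cauchy_schwarz_sqr.
Qed.

Lemma dot_le_norm n x y : dot n x y <= normRn n x * normRn n y.
Proof. eapply Rle_trans; [apply Rle_abs | apply cauchy_schwarz]. Qed.

Lemma norm_padd n x y : normRn n (padd x y) <= normRn n x + normRn n y.
Proof.
  pose proof (norm_ge0 n x); pose proof (norm_ge0 n y).
  apply norm_le; [lra|].
  dot_expand; rewrite (dot_comm n y x), <- !norm_sqr.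
  pose proof (dot_le_norm n x y); nra.
Qed.

Lemma norm_pscal n t x : normRn n (pscal t x) = Rabs t * normRn n x.
Proof.
  unfold normRn; dot_expand; rewrite <- sqrt_Rsqr_abs, <- sqrt_mult_alt by apply Rle_0_sqr.
  f_equal; unfold Rsqr; ring.
Qed.

Lemma dist_ge0 n x y : 0 <= distRn n x y.
Proof. apply norm_ge0. Qed.

Lemma dist_sym n x y : distRn n x y = distRn n y x.
Proof.
  unfold distRn, normRn; f_equal; dot_expand; rewrite (dot_comm n y x); ring.
Qed.

Lemma dist_triangle n x y z : distRn n x z <= distRn n x y + distRn n y z.
Proof.
  unfold distRn; replace (psub x z) with (padd (psub x y) (psub y z)).
  - apply norm_padd.
  - apply functional_extensionality; intro i; unfold padd, psub; ring.
Qed.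

Lemma dot_dist n x y z : dot n x y - dot n x z <= normRn n x * distRn n y z.
Proof. rewrite <- dot_psub_r; apply dot_le_norm. Qed.

Lemma coord_le_norm n x i : (i < n)%nat -> Rabs (x i) <= normRn n x.
Proof.
  intro Hi; unfold normRn; rewrite <- sqrt_Rsqr_abs; apply sqrt_le_1_alt; unfold Rsqr.
  induction n as [|n IH]; [lia|]; simpl.
  destruct (Nat.eq_dec i n) as [-> | Hne].
  - pose proof (dot_self_ge0 n x); lra.
  - assert (x i * x i <= dot n x x) by (apply IH; lia); nra.
Qed.

Lemma norm_le_coord n x e : 0 <= e ->
  (forall i, (i < n)%nat -> Rabs (x i) <= e) -> normRn n x <= INR n * e.
Proof.
  intros He H; apply norm_le; [apply Rmult_le_pos; [apply pos_INR | exact He]|].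
  induction n as [|n IH]; [simpl; lra|].
  assert (IH' : dot n x x <= INR n * e * (INR n * e)) by (apply IH; intros; apply H; lia).
  assert (Hn : Rabs (x n) <= e) by (apply H; lia).
  rewrite S_INR; simpl; pose proof (pos_INR n) as Hp.
  assert (x n * x n <= e * e) by
    (pose proof (Rsqr_abs (x n)) as Ha; unfold Rsqr in Ha; rewrite Ha;
     pose proof (Rabs_pos (x n)); nra).
  assert (0 <= INR n * (e * e)) by (apply Rmult_le_pos; nra).
  nra.
Qed.

Lemma unit_vec_dot n u : unit_vec n u -> dot n u u = 1.
Proof. intros [_ H]; rewrite <- norm_sqr, H; ring. Qed.

Lemma reflect_dot n u x y : dot n (reflect_hyp n u x) y = dot n x (reflect_hyp n u y).
Proof. unfold reflect_hyp; dot_expand; rewrite (dot_comm n u y); ring. Qed.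

Lemma reflect_reflect n u x : dot n u u = 1 -> reflect_hyp n u (reflect_hyp n u x) = x.
Proof.
  intro Hu; apply functional_extensionality; intro i; unfold reflect_hyp.
  dot_expand; rewrite Hu; unfold psub, pscal; ring.
Qed.

Lemma reflect_norm n u x : dot n u u = 1 -> normRn n (reflect_hyp n u x) = normRn n x.
Proof.
  intro Hu; unfold normRn; rewrite reflect_dot, reflect_reflect by exact Hu; reflexivity.
Qed.

Lemma reflect_dist n u x y : dot n u u = 1 ->
  distRn n (reflect_hyp n u x) y = distRn n x (reflect_hyp n u y).
Proof.
  intro Hu; unfold distRn; rewrite <- (reflect_norm n u (psub x _)) by exact Hu.
  f_equal; apply functional_extensionality; intro i.
  unfold reflect_hyp; dot_expand; rewrite Hu; unfold psub, pscal; ring.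
Qed.

Lemma reflect_inRn n u x : inRn n u -> inRn n x -> inRn n (reflect_hyp n u x).
Proof.
  intros Hu Hx i Hi; unfold reflect_hyp, psub, pscal; rewrite Hu, Hx by exact Hi; ring.
Qed.

(** A total supremum, with an unspecified value when [E] is empty or unbounded above; hence the side
    conditions of [lub_spec]. *)
Definition lub (E : R -> Prop) : R := epsilon (inhabits 0) (is_lub E).

Lemma lub_spec E b : (exists e, E e) -> (forall e, E e -> e <= b) -> is_lub E (lub E).
Proof.
  intros Hne Hb; unfold lub; apply epsilon_spec.
  destruct (completeness E) as [s Hs]; [now exists b | exact Hne | now exists s].
Qed.

Definition supp (n : nat) (K : set_pt) (y : pt) : R :=
  lub (fun s => exists x, K x /\ s = dot n x y).

Definition bounded_by (n : nat) (r : R) (K : set_pt) : Prop :=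
  forall x, K x -> normRn n x <= r.

Lemma supp_is_lub n r K y : nonempty K -> bounded_by n r K ->
  is_lub (fun s => exists x, K x /\ s = dot n x y) (supp n K y).
Proof.
  intros [x0 H0] Hb; apply (lub_spec _ (r * normRn n y)).
  - now exists (dot n x0 y), x0.
  - intros s (x & Hx & ->); pose proof (dot_le_norm n x y); pose proof (Hb x Hx).
    pose proof (norm_ge0 n y); nra.
Qed.

Lemma supp_ge n r K x y : bounded_by n r K -> K x -> dot n x y <= supp n K y.
Proof.
  intros Hb Hx; destruct (supp_is_lub n r K y) as [Hu _]; [now exists x | exact Hb |].
  apply Hu; now exists x.
Qed.

Lemma supp_le n r K y c : nonempty K -> bounded_by n r K ->
  (forall x, K x -> dot n x y <= c) -> supp n K y <= c.
Proof.
  intros Hne Hb H; destruct (supp_is_lub n r K y Hne Hb) as [_ Hl].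
  apply Hl; intros s (x & Hx & ->); auto.
Qed.

(** The two properties of support functions of subsets of the ball of radius [r] on which the
    compactness and energy arguments rest; the one radius [r] serves as bound and as Lipschitz
    constant. *)
Definition lip_ball (n : nat) (r : R) (h : pt -> R) : Prop :=
  (forall x, normRn n x <= 1 -> Rabs (h x) <= r) /\
  (forall x y, normRn n x <= 1 -> normRn n y <= 1 -> h x - h y <= r * distRn n x y).

Lemma supp_lip n r K : nonempty K -> bounded_by n r K -> lip_ball n r (supp n K).
Proof.
  intros Hne Hb; split.
  - intros y Hy; apply Rabs_le; destruct Hne as [x0 H0]; split.
    + pose proof (supp_ge n r K x0 y Hb H0); pose proof (Hb x0 H0).
      pose proof (cauchy_schwarz n x0 y) as Hc; pose proof (Rle_abs (- dot n x0 y)).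
      rewrite Rabs_Ropp in *; pose proof (norm_ge0 n x0); pose proof (norm_ge0 n y); nra.
    + apply (supp_le n r); [now exists x0 | exact Hb |]; intros x Hx.
      pose proof (dot_le_norm n x y); pose proof (Hb x Hx); pose proof (norm_ge0 n x).
      pose proof (norm_ge0 n y); nra.
  - intros y z _ _.
    enough (supp n K y <= supp n K z + r * distRn n y z) by lra.
    apply (supp_le n r); [exact Hne | exact Hb |]; intros x Hx.
    pose proof (supp_ge n r K x z Hb Hx); pose proof (dot_dist n x y z).
    pose proof (Hb x Hx); pose proof (dist_ge0 n y z); nra.
Qed.

Lemma proj_dot n u x : dot n u u = 1 -> dot n (proj n u x) u = 0.
Proof. intro Hu; unfold proj; dot_expand; rewrite Hu; ring. Qed.

Lemma steiner_nonempty n u K : nonempty K -> nonempty (steiner n u K).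
Proof.
  intros [k Hk]; exists (padd (proj n u k) (pscal 0 u)), (proj n u k), 0.
  split; [reflexivity|]; split; [now exists k|].
  assert (E : padd (proj n u k) (pscal (dot n k u) u) = k)
    by (apply functional_extensionality; intro i; unfold proj, padd, psub, pscal; ring).
  exists (dot n k u), (dot n k u); rewrite E, Rabs_R0; repeat split; auto; lra.
Qed.

Lemma steiner_convex n u K : convex K -> convex (steiner n u K).
Proof.
  intros HK y1 y2 s (x1 & t1 & -> & (k1 & Hk1 & ->) & a1 & b1 & Ha1 & Hb1 & Ht1)
    (x2 & t2 & -> & (k2 & Hk2 & ->) & a2 & b2 & Ha2 & Hb2 & Ht2) Hs.
  set (comb := fun c1 c2 : R => (1 - s) * c1 + s * c2).
  set (k := padd (pscal (1 - s) k1) (pscal s k2)).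
  (* Base point and height above it both depend linearly on the point, so chords combine to a chord
     over the combined base point, and their lengths combine likewise. *)
  assert (E : forall c1 c2, padd (pscal (1 - s) (padd (proj n u k1) (pscal c1 u)))
     (pscal s (padd (proj n u k2) (pscal c2 u))) = padd (proj n u k) (pscal (comb c1 c2) u)).
  { intros c1 c2; apply functional_extensionality; intro i; unfold proj, k, comb.
    dot_expand; unfold padd, psub, pscal; ring. }
  exists (proj n u k), (comb t1 t2); split; [apply E|]; split.
  { exists k; split; [now apply HK | reflexivity]. }
  exists (comb a1 a2), (comb b1 b2); rewrite <- !E.
  split; [now apply HK | split; [now apply HK|]].
  unfold comb; pose proof (Rabs_triang ((1 - s) * t1) (s * t2)) as HT.
  rewrite !Rabs_mult, (Rabs_right (1 - s)), (Rabs_right s) in HT by lra.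
  nra.
Qed.

(* Steiner symmetrization lies inside the Minkowski symmetrization
   [(K + reflect_hyp n u K) / 2]. *)
Lemma steiner_dot_le n r u K y z : dot n u u = 1 -> bounded_by n r K ->
  steiner n u K y ->
  dot n y z <= (supp n K z + supp n K (reflect_hyp n u z)) / 2.
Proof.
  intros Hu Hb (x & t & -> & (k & _ & Ex) & a & b & Ha & Hb' & Ht).
  assert (Hx : dot n x u = 0) by (rewrite Ex; now apply proj_dot).
  pose proof (supp_ge n r K _ z Hb Ha) as A1; pose proof (supp_ge n r K _ z Hb Hb') as B1.
  pose proof (supp_ge n r K _ (reflect_hyp n u z) Hb Ha) as A2.
  pose proof (supp_ge n r K _ (reflect_hyp n u z) Hb Hb') as B2.
  revert A1 B1 A2 B2; unfold reflect_hyp; dot_expand; rewrite Hu, Hx, (dot_comm n z u).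
  intros A1 B1 A2 B2.
  pose proof (Rle_abs t); pose proof (Rle_abs (- t)); rewrite Rabs_Ropp in *.
  (* If [dot n u z] is nonnegative, the end [b] is tested against [z] and the end [a] against the
     reflected direction; otherwise the ends exchange roles. *)
  destruct (Rle_dec 0 (dot n u z)); nra.
Qed.

Lemma steiner_bounded n r u K : dot n u u = 1 -> 0 <= r -> bounded_by n r K ->
  bounded_by n r (steiner n u K).
Proof.
  intros Hu Hr Hb y (x & t & -> & (k & _ & Ex) & a & b & Ha & Hb' & Ht).
  assert (Hx : dot n x u = 0) by (rewrite Ex; now apply proj_dot).
  assert (N : forall c, dot n (padd x (pscal c u)) (padd x (pscal c u)) = dot n x x + c * c)
    by (intro c; dot_expand; rewrite (dot_comm n u x), Hu, Hx; ring).
  assert (Q : forall c, K (padd x (pscal c u)) -> dot n x x + c * c <= r * r).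
  { intros c Hc; rewrite <- N, <- norm_sqr; specialize (Hb _ Hc).
    pose proof (norm_ge0 n (padd x (pscal c u))); nra. }
  apply norm_le; [exact Hr|]; rewrite N.
  pose proof (Q a Ha); pose proof (Q b Hb').
  pose proof (Rabs_pos t); pose proof (Rsqr_abs t) as E; unfold Rsqr in E.
  assert (4 * (t * t) <= (b - a) * (b - a)) by (rewrite E; nra).
  (* The square of [a + b] turns [4 t^2 <= (b - a)^2] into [t^2 <= (a^2 + b^2) / 2], an average of
     two quantities already bounded. *)
  pose proof (Rle_0_sqr (a + b)); unfold Rsqr in *; nra.
Qed.

Lemma steiner_supp_le n r u K z : dot n u u = 1 -> 0 <= r -> nonempty K -> bounded_by n r K ->
  supp n (steiner n u K) z <= (supp n K z + supp n K (reflect_hyp n u z)) / 2.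
Proof.
  intros Hu Hr Hne Hb; apply (supp_le n r).
  - now apply steiner_nonempty.
  - now apply steiner_bounded.
  - intros y Hy; now apply (steiner_dot_le n r).
Qed.

(** * Nets and the isometry-invariant energy *)

Definition is_net (n : nat) (e : R) (X : list pt) : Prop :=
  (forall x, In x X -> normRn n x <= 1) /\
  (forall y, normRn n y <= 1 -> exists x, In x X /\ distRn n x y <= e).

Lemma interval_net e k : 0 < e ->
  exists G : list R, forall a s, a <= s <= a + INR k * e ->
    exists g, In g G /\ Rabs (a + g - s) <= e.
Proof.
  intro He; exists (map (fun j => INR j * e) (seq 0 (S k))).
  intros a s Hs; induction k as [|k IH].
  - exists 0; simpl in *; split; [left; ring | apply Rabs_le; lra].
  - destruct (Rle_dec s (a + INR k * e)) as [H | H].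
    + destruct IH as (g & Hg & Hd); [lra|].
      exists g; split; [|exact Hd]; rewrite seq_S, map_app; apply in_or_app; now left.
    + exists (INR (S k) * e); split.
      * apply in_map_iff; exists (S k); split; [reflexivity | apply in_seq; lia].
      * rewrite S_INR in *; apply Rabs_le; lra.
Qed.

Lemma box_net n e : 0 < e ->
  exists X : list pt, forall y, (forall i, (i < n)%nat -> Rabs (y i) <= 1) ->
    exists x, In x X /\ forall i, (i < n)%nat -> Rabs (x i - y i) <= e.
Proof.
  intro He; induction n as [|n [X HX]].
  - exists ((fun _ => 0) :: nil); intros y _; exists (fun _ => 0); split; [now left | lia].
  - destruct (INR_unbounded (2 / e)) as [k Hk].
    destruct (interval_net e k He) as [G HG].
    exists (flat_map (fun g => map (fun x i => if Nat.eq_dec i n then -1 + g else x i) X) G).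
    intros y Hy.
    destruct (HX y) as (x & Hx & Hd); [intros; apply Hy; lia|].
    destruct (HG (-1) (y n)) as (g & Hg & Hgd).
    { assert (Hn : Rabs (y n) <= 1) by (apply Hy; lia).
      assert (2 < INR k * e) by
        (replace 2 with (2 / e * e) by (field; lra); apply Rmult_lt_compat_r; assumption).
      pose proof (Rle_abs (y n)); pose proof (Rle_abs (- y n)); rewrite Rabs_Ropp in *; lra. }
    exists (fun i => if Nat.eq_dec i n then -1 + g else x i); split.
    + apply in_flat_map; exists g; split; [exact Hg|].
      apply in_map_iff; exists x; split; [reflexivity | exact Hx].
    + intros i Hi; destruct (Nat.eq_dec i n) as [-> | Hne]; [exact Hgd | apply Hd; lia].
Qed.

(** Functions in [lip_ball] are controlled only on the unit ball, so net points must lie there. Each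
    point of [X] within [e] of the ball is replaced by a ball point that close to it, which doubles
    the radius. *)
Lemma net_inside n e X :
  exists X', (forall x, In x X' -> normRn n x <= 1) /\
    forall y, normRn n y <= 1 -> (exists x, In x X /\ distRn n x y <= e) ->
      exists x, In x X' /\ distRn n x y <= e + e.
Proof.
  induction X as [|x0 X (X' & Hn & HX')].
  - exists nil; split; [intros x [] | intros y _ (x & [] & _)].
  - destruct (classic (exists y, normRn n y <= 1 /\ distRn n x0 y <= e)) as [(z & Hz & Hd) | No].
    + exists (z :: X'); split; [intros x [<- | Hx]; auto|].
      intros y Hy (x & [<- | Hx] & Hxy).
      * exists z; split; [now left|].
        pose proof (dist_triangle n z x0 y); rewrite (dist_sym n z x0) in *; lra.
      * destruct (HX' y Hy) as (x' & Hx' & Hd'); [now exists x|].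
        exists x'; split; [now right | exact Hd'].
    + exists X'; split; [exact Hn|].
      intros y Hy (x & [<- | Hx] & Hxy); [exfalso; apply No; now exists y|].
      apply HX'; [exact Hy | now exists x].
Qed.

Lemma ball_net n e : 0 < e -> exists X, is_net n e X.
Proof.
  intro He.
  assert (Hp : 0 < INR (S n)) by (apply lt_0_INR; lia).
  (* A coordinate error [d] costs at most [n d <= e / 2] in norm, which [net_inside] doubles. Using
     [S n] keeps the divisor nonzero in dimension zero. *)
  set (d := e / (2 * INR (S n))).
  assert (Hd : 0 < d) by (apply Rdiv_lt_0_compat; lra).
  destruct (box_net n d Hd) as [X HX].
  destruct (net_inside n (e / 2) X) as (X' & Hn & HX'); exists X'; split; [exact Hn|].
  intros y Hy; destruct (HX' y Hy) as (x' & Hx' & Hd').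
  - destruct (HX y) as (x & Hx & Hxy).
    { intros i Hi; pose proof (coord_le_norm n y i Hi); lra. }
    exists x; split; [exact Hx|].
    apply Rle_trans with (INR n * d); [now apply norm_le_coord; [lra|] |].
    replace (e / 2) with (INR (S n) * d) by (unfold d; field; lra).
    rewrite S_INR; lra.
  - exists x'; split; [exact Hx' | lra].
Qed.

Definition lsum (a : pt -> R) (X : list pt) : R := fold_right (fun x s => a x + s) 0 X.

Lemma lsum_le a b X : (forall x, In x X -> a x <= b x) -> lsum a X <= lsum b X.
Proof.
  induction X as [|x X IH]; intro H; simpl; [lra|].
  pose proof (H x (or_introl eq_refl)).
  assert (lsum a X <= lsum b X) by (apply IH; intros; apply H; now right); lra.
Qed.

Lemma lsum_lin s t a b X :
  lsum (fun x => s * a x + t * b x) X = s * lsum a X + t * lsum b X.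
Proof. induction X as [|x X IH]; simpl; [ring | rewrite IH; ring]. Qed.

Lemma lsum_const c X : lsum (fun _ => c) X = INR (length X) * c.
Proof.
  induction X as [|x X IH]; [simpl; ring|].
  change (lsum (fun _ => c) (x :: X)) with (c + lsum (fun _ => c) X).
  rewrite IH; change (length (x :: X)) with (S (length X)); rewrite S_INR; ring.
Qed.

Lemma lsum_ge0 a X : (forall x, In x X -> 0 <= a x) -> 0 <= lsum a X.
Proof.
  intro H; rewrite <- (Rmult_0_r (INR (length X))), <- lsum_const.
  now apply lsum_le.
Qed.

Lemma lsum_term a X x : (forall z, In z X -> 0 <= a z) -> In x X -> a x <= lsum a X.
Proof.
  induction X as [|x0 X IH]; intros H Hx; [destruct Hx|]; simpl.
  pose proof (H x0 (or_introl eq_refl)).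
  assert (0 <= lsum a X) by (apply lsum_ge0; intros; apply H; now right).
  destruct Hx as [<- | Hx]; [lra|].
  assert (a x <= lsum a X) by (apply IH; [intros; apply H; now right | exact Hx]); lra.
Qed.

(* The adjunction between [g] and [g'] says that they are mutually inverse isometries. *)
Definition isom (n : nat) (g : pt -> pt) : Prop :=
  (forall x, normRn n (g x) = normRn n x) /\
  exists g', (forall x, normRn n (g' x) = normRn n x) /\
    forall x y, distRn n (g x) y = distRn n x (g' y).

Lemma isom_id n : isom n (fun x => x).
Proof. split; [reflexivity | exists (fun x => x); split; reflexivity]. Qed.

Lemma isom_reflect n u g : dot n u u = 1 -> isom n g ->
  isom n (fun x => reflect_hyp n u (g x)).
Proof.
  intros Hu (Hg & g' & Hg' & Hgg'); split.
  - intro x; rewrite reflect_norm by exact Hu; apply Hg.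
  - exists (fun y => g' (reflect_hyp n u y)); split.
    + intro x; rewrite Hg'; now apply reflect_norm.
    + intros x y; rewrite reflect_dist by exact Hu; apply Hgg'.
Qed.

(** To approximate [y], approximate [g' y] in [X] and move the point found by [g]. *)
Lemma isom_net n e X g : is_net n e X -> isom n g -> is_net n e (map g X).
Proof.
  intros [Hn HX] (Hg & g' & Hg' & Hgg'); split.
  - intros x Hx; apply in_map_iff in Hx; destruct Hx as (z & <- & Hz); rewrite Hg; auto.
  - intros y Hy; destruct (HX (g' y)) as (x & Hx & Hd); [now rewrite Hg'|].
    exists (g x); rewrite Hgg'; split; [now apply in_map | exact Hd].
Qed.

(** The shift moves the values of a function in [lip_ball] into [[1, 2r + 1]], where the square is
    increasing with slope between [2] and [2 (2r + 1)]. *)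
Definition shifted_sqr (r : R) (h : pt -> R) (x : pt) : R := (h x + (r + 1)) * (h x + (r + 1)).

(* A stand-in for the integral of [(h + r + 1)^2] over the ball: taking the supremum
   over all isometries makes a sum over a finite net exactly rotation invariant. *)
Definition energy (n : nat) (r : R) (X : list pt) (h : pt -> R) : R :=
  lub (fun s => exists g, isom n g /\ s = lsum (fun x => shifted_sqr r h (g x)) X).

Lemma lip_bounds n r h x : lip_ball n r h -> normRn n x <= 1 ->
  1 <= h x + (r + 1) <= 2 * r + 1.
Proof.
  intros [Hb _] Hx; specialize (Hb x Hx).
  pose proof (Rle_abs (h x)); pose proof (Rle_abs (- h x)); rewrite Rabs_Ropp in *; lra.
Qed.

Definition in_ball (n : nat) (X : list pt) : Prop := forall x, In x X -> normRn n x <= 1.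

Lemma energy_is_lub n r X h : in_ball n X -> lip_ball n r h ->
  is_lub (fun s => exists g, isom n g /\ s = lsum (fun x => shifted_sqr r h (g x)) X)
    (energy n r X h).
Proof.
  intros HX Hh; apply (lub_spec _ (INR (length X) * ((2 * r + 1) * (2 * r + 1)))).
  - exists (lsum (fun x => shifted_sqr r h x) X), (fun x => x); split; [apply isom_id | reflexivity].
  - intros s (g & [Hg _] & ->); rewrite <- lsum_const; apply lsum_le.
    intros x Hx; unfold shifted_sqr.
    assert (1 <= h (g x) + (r + 1) <= 2 * r + 1)
      by (apply (lip_bounds n); [exact Hh | rewrite Hg; auto]).
    nra.
Qed.

Lemma energy_ge n r X h g : in_ball n X -> lip_ball n r h -> isom n g ->
  lsum (fun x => shifted_sqr r h (g x)) X <= energy n r X h.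
Proof.
  intros HX Hh Hg; destruct (energy_is_lub n r X h HX Hh) as [Hu _]; apply Hu; now exists g.
Qed.

Lemma energy_le n r X h c : in_ball n X -> lip_ball n r h ->
  (forall g, isom n g -> lsum (fun x => shifted_sqr r h (g x)) X <= c) ->
  energy n r X h <= c.
Proof.
  intros HX Hh H; destruct (energy_is_lub n r X h HX Hh) as [_ Hl]; apply Hl.
  intros s (g & Hg & ->); auto.
Qed.

Lemma energy_approx n r X h d : in_ball n X -> lip_ball n r h -> 0 < d ->
  exists g, isom n g /\ energy n r X h - d < lsum (fun x => shifted_sqr r h (g x)) X.
Proof.
  intros HX Hh Hd; apply NNPP; intro No.
  enough (energy n r X h <= energy n r X h - d) by lra.
  apply energy_le; [exact HX | exact Hh |]; intros g Hg.
  apply Rnot_lt_le; intro Hlt; apply No; now exists g.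
Qed.

Lemma energy_ge0 n r X h : in_ball n X -> lip_ball n r h -> 0 <= energy n r X h.
Proof.
  intros HX Hh; eapply Rle_trans; [|apply (energy_ge n r X h (fun x => x)); auto using isom_id].
  apply lsum_ge0; intros; apply Rle_0_sqr.
Qed.

Definition midpoint_bound (n : nat) (u : pt) (h k : pt -> R) : Prop :=
  forall x, normRn n x <= 1 -> k x <= (h x + h (reflect_hyp n u x)) / 2.

(** Quantitative convexity of the square: [((a + b) / 2)^2 = (a^2 + b^2) / 2 - (a - b)^2 / 4]. Both
    [g] and [g] followed by the reflection compete in the supremum, so the sums [A] and [B] are each
    at most the energy of [h]. *)
Lemma energy_midpoint_gap n r X u h k g : dot n u u = 1 -> in_ball n X ->
  lip_ball n r h -> lip_ball n r k -> midpoint_bound n u h k -> isom n g ->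
  lsum (fun x => shifted_sqr r k (g x)) X
    + lsum (fun x => (h (g x) - h (reflect_hyp n u (g x)))
                     * (h (g x) - h (reflect_hyp n u (g x)))) X / 4
  <= energy n r X h.
Proof.
  intros Hu HX Hh Hk Hm Hg.
  set (D := fun x => (h (g x) - h (reflect_hyp n u (g x)))
                     * (h (g x) - h (reflect_hyp n u (g x)))).
  set (A := fun x => shifted_sqr r h (g x)).
  set (B := fun x => shifted_sqr r h (reflect_hyp n u (g x))).
  assert (HA : lsum A X <= energy n r X h) by exact (energy_ge n r X h g HX Hh Hg).
  assert (HB : lsum B X <= energy n r X h)
    by exact (energy_ge n r X h _ HX Hh (isom_reflect n u g Hu Hg)).
  set (C := fun x => shifted_sqr r k (g x)).
  enough (1 * lsum C X + / 4 * lsum D X <= / 2 * lsum A X + / 2 * lsum B X) by lra.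
  rewrite <- !lsum_lin; apply lsum_le; intros x Hx; unfold A, B, C, D, shifted_sqr.
  assert (Hgx : normRn n (g x) <= 1) by (destruct Hg as [Hg _]; rewrite Hg; auto).
  pose proof (Hm _ Hgx) as M; pose proof (lip_bounds n r k _ Hk Hgx) as [L _].
  set (a := h (g x)) in *; set (b := h (reflect_hyp n u (g x))) in *; set (c := k (g x)) in *.
  assert ((c + (r + 1)) * (c + (r + 1)) <= ((a + b) / 2 + (r + 1)) * ((a + b) / 2 + (r + 1)))
    by (apply Rmult_le_compat; lra).
  nra.
Qed.

Lemma energy_midpoint_le n r X u h k : dot n u u = 1 -> in_ball n X ->
  lip_ball n r h -> lip_ball n r k -> midpoint_bound n u h k ->
  energy n r X k <= energy n r X h.
Proof.
  intros Hu HX Hh Hk Hm; apply energy_le; [exact HX | exact Hk |]; intros g Hg.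
  pose proof (energy_midpoint_gap n r X u h k g Hu HX Hh Hk Hm Hg).
  assert (0 <= lsum (fun x => (h (g x) - h (reflect_hyp n u (g x)))
                     * (h (g x) - h (reflect_hyp n u (g x)))) X)
    by (apply lsum_ge0; intros; apply Rle_0_sqr).
  lra.
Qed.

(** For a [g] optimal for [k] up to [d^2 / 8], the gap estimate bounds the sum of squared reflection
    differences of [h] by [d^2], hence each difference on the moved net by [d]. Passing from a net
    point to [y] costs [r e] at [y] and [r e] at its mirror image. *)
Lemma energy_drop_small n r e X u h k d : 0 <= r -> dot n u u = 1 -> is_net n e X ->
  lip_ball n r h -> lip_ball n r k -> midpoint_bound n u h k -> 0 < d ->
  energy n r X h <= energy n r X k + d * d / 8 ->
  forall y, normRn n y <= 1 -> Rabs (h y - h (reflect_hyp n u y)) <= d + 2 * r * e.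
Proof.
  intros Hr Hu HX Hh Hk Hm Hd HE y Hy.
  destruct (energy_approx n r X k (d * d / 8)) as (g & Hg & Hlt);
    [exact (proj1 HX) | exact Hk | nra |].
  pose proof (energy_midpoint_gap n r X u h k g Hu (proj1 HX) Hh Hk Hm Hg) as Hgap.
  destruct (isom_net n e X g HX Hg) as [Hball HgX].
  destruct (HgX y Hy) as (gx & Hin & Hdist).
  pose proof (Hball gx Hin) as Hn.
  apply in_map_iff in Hin; destruct Hin as (x & <- & Hx).
  pose proof (lsum_term (fun x => (h (g x) - h (reflect_hyp n u (g x)))
                     * (h (g x) - h (reflect_hyp n u (g x)))) X x
                     (fun z _ => Rle_0_sqr _) Hx) as Ht; simpl in Ht.
  destruct Hh as [_ Hl].
  assert (HRd : distRn n (reflect_hyp n u (g x)) (reflect_hyp n u y) = distRn n (g x) y)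
    by (rewrite reflect_dist, reflect_reflect; auto).
  pose proof (Hl y (g x) Hy Hn) as L1; pose proof (Hl (g x) y Hn Hy) as L2.
  rewrite (dist_sym n y) in L1.
  assert (HRy : normRn n (reflect_hyp n u y) <= 1) by now rewrite reflect_norm.
  assert (HRg : normRn n (reflect_hyp n u (g x)) <= 1) by now rewrite reflect_norm.
  pose proof (Hl _ _ HRy HRg) as L3; pose proof (Hl _ _ HRg HRy) as L4.
  rewrite (dist_sym n (reflect_hyp n u y)) in L3; rewrite HRd in L3, L4.
  assert (r * distRn n (g x) y <= r * e) by (apply Rmult_le_compat_l; lra).
  set (a := h (g x)) in *; set (b := h (reflect_hyp n u (g x))) in *.
  assert ((a - b) * (a - b) <= d * d) by lra.
  assert (- d <= a - b <= d) by nra.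
  apply Rabs_le; lra.
Qed.

Lemma energy_rigid n r e X f k d : 0 <= r -> is_net n e X ->
  lip_ball n r f -> lip_ball n r k -> 0 <= d ->
  (forall x, normRn n x <= 1 -> k x <= f x + d) ->
  energy n r X f <= energy n r X k ->
  forall y, normRn n y <= 1 ->
    f y <= k y + 2 * r * e + (INR (length X) * (2 * (2 * r + 1)) + 1) * d.
Proof.
  intros Hr HX Hf Hk Hd Hle HE y Hy; apply Rnot_lt_le; intro Hlt.
  set (M := 2 * (2 * r + 1)) in *.
  (* The excess in the negated claim serves as the tolerance in choosing [g]; the net estimate at
     the end then contradicts its own size. *)
  set (eta := f y - k y - 2 * r * e - (INR (length X) * M + 1) * d) in *.
  assert (Heta : 0 < eta) by (unfold eta; lra).
  destruct (energy_approx n r X k eta) as (g & Hg & Hlt');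
    [exact (proj1 HX) | exact Hk | exact Heta |].
  pose proof (energy_ge n r X f g (proj1 HX) Hf Hg) as Hfe.
  destruct (isom_net n e X g HX Hg) as [Hball HgX].
  destruct (HgX y Hy) as (gx & Hin & Hdist).
  pose proof (Hball gx Hin) as Hn.
  apply in_map_iff in Hin; destruct Hin as (x & <- & Hx).
  (* Adding [d M] makes every term nonnegative, since [k] may exceed [f] by [d] and [M] bounds the
     sum of the shifted values. A single term is then at most the whole sum; it dominates [f - k]
     because the shifted values are at least [1]. *)
  set (T := fun x => 1 * (1 * shifted_sqr r f (g x) + (-1) * shifted_sqr r k (g x)) + d * M).
  assert (HT : forall z, In z X -> 0 <= T z /\ f (g z) - k (g z) <= T z).
  { intros z Hz; unfold T, shifted_sqr.
    assert (Hgz : normRn n (g z) <= 1) by (apply Hball; now apply in_map).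
    pose proof (lip_bounds n r f _ Hf Hgz); pose proof (lip_bounds n r k _ Hk Hgz).
    pose proof (Hle _ Hgz) as Hz'.
    set (a := f (g z) + (r + 1)) in *; set (b := k (g z) + (r + 1)) in *.
    assert (Hab : b <= a + d) by (unfold a, b; lra).
    replace (f (g z) - k (g z)) with (a - b) by (unfold a, b; ring).
    replace (1 * (1 * (a * a) + -1 * (b * b)) + d * M) with ((a - b) * (a + b) + d * M) by ring.
    unfold M; destruct (Rle_dec b a); split; nra. }
  pose proof (lsum_term T X x (fun z Hz => proj1 (HT z Hz)) Hx) as Hterm.
  destruct (HT x Hx) as [_ Hx2].
  assert (ET : lsum T X = lsum (fun x => shifted_sqr r f (g x)) X
     - lsum (fun x => shifted_sqr r k (g x)) X + INR (length X) * (d * M)).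
  { transitivity (1 * (1 * lsum (fun x => shifted_sqr r f (g x)) X
        + -1 * lsum (fun x => shifted_sqr r k (g x)) X) + 1 * lsum (fun _ => d * M) X).
    - rewrite <- !lsum_lin; unfold T; f_equal; apply functional_extensionality; intro; ring.
    - rewrite lsum_const; ring. }
  destruct Hf as [_ Lf]; destruct Hk as [_ Lk].
  pose proof (Lf y (g x) Hy Hn) as L1; pose proof (Lk (g x) y Hn Hy) as L2.
  rewrite (dist_sym n y) in L1.
  assert (r * distRn n (g x) y <= r * e) by (apply Rmult_le_compat_l; lra).
  unfold eta in *; nra.
Qed.

Lemma energy_lipschitz n r X f k d : in_ball n X -> lip_ball n r f -> lip_ball n r k -> 0 <= d ->
  (forall x, normRn n x <= 1 -> f x <= k x + d) ->
  energy n r X f <= energy n r X k + INR (length X) * (2 * (2 * r + 1)) * d.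
Proof.
  intros HX Hf Hk Hd Hle; apply energy_le; [exact HX | exact Hf |]; intros g Hg.
  pose proof (energy_ge n r X k g HX Hk Hg) as Hke.
  set (A := fun x => shifted_sqr r f (g x)).
  enough (1 * lsum A X <= 1 * lsum (fun x => shifted_sqr r k (g x)) X
     + 1 * lsum (fun _ => 2 * (2 * r + 1) * d) X) as HH
    by (rewrite lsum_const in HH; lra).
  rewrite <- lsum_lin, <- (Rplus_0_r (1 * lsum A X)).
  (* A dummy second summand gives the left side the shape required by [lsum_lin]. *)
  replace 0 with (0 * lsum A X) by ring; rewrite <- lsum_lin.
  apply lsum_le; intros x Hx; unfold A, shifted_sqr.
  assert (Hgx : normRn n (g x) <= 1) by (destruct Hg as [Hg _]; rewrite Hg; auto).
  pose proof (lip_bounds n r f _ Hf Hgx); pose proof (lip_bounds n r k _ Hk Hgx).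
  pose proof (Hle _ Hgx).
  set (a := f (g x) + (r + 1)) in *; set (b := k (g x) + (r + 1)) in *.
  assert (a <= b + d) by (unfold a, b; lra).
  nra.
Qed.

(** * Extraction and convergence of support functions *)

Definition inf_often (S : nat -> Prop) : Prop := forall N, exists i, (N <= i)%nat /\ S i.

Lemma inf_often_split (S A : nat -> Prop) : inf_often S ->
  inf_often (fun i => S i /\ A i) \/ inf_often (fun i => S i /\ ~ A i).
Proof.
  intro HS; apply NNPP; intro No; apply not_or_and in No; destruct No as [N1 N2].
  apply not_all_ex_not in N1; apply not_all_ex_not in N2.
  destruct N1 as [a Ha], N2 as [b Hb].
  destruct (HS (max a b)) as (i & Hi & Si).
  destruct (classic (A i)); [apply Ha | apply Hb]; exists i; repeat split; auto; lia.
Qed.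

Lemma interval_pigeonhole (F : nat -> R) e k : 0 < e -> forall a S, inf_often S ->
  (forall i, S i -> a <= F i <= a + INR k * e) ->
  exists S' : nat -> Prop, (forall i, S' i -> S i) /\ inf_often S' /\
    forall i j, S' i -> S' j -> Rabs (F i - F j) <= e.
Proof.
  intro He; induction k as [|k IH]; intros a S HS HF.
  - exists S; repeat split; auto; intros i j Hi Hj.
    pose proof (HF i Hi); pose proof (HF j Hj); simpl in *; apply Rabs_le; lra.
  - destruct (inf_often_split S (fun i => F i <= a + e) HS) as [H | H].
    + exists (fun i => S i /\ F i <= a + e); repeat split; [tauto | exact H |].
      intros i j [Hi Ui] [Hj Uj]; pose proof (HF i Hi); pose proof (HF j Hj).
      apply Rabs_le; lra.
    + destruct (IH (a + e) _ H) as (S' & Hsub & Hinf & HS').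
      { intros i [Hi Ui]; pose proof (HF i Hi); rewrite S_INR in *; lra. }
      exists S'; repeat split; auto; intros i Hi; now apply Hsub.
Qed.

Lemma list_pigeonhole (T : Type) (F : nat -> T -> R) r e (X : list T) : 0 < e ->
  (forall i x, In x X -> Rabs (F i x) <= r) ->
  forall S, inf_often S ->
  exists S' : nat -> Prop, (forall i, S' i -> S i) /\ inf_often S' /\
    forall i j x, S' i -> S' j -> In x X -> Rabs (F i x - F j x) <= e.
Proof.
  intro He; induction X as [|x0 X IH]; intros HF S HS.
  - exists S; repeat split; auto; intros i j x _ _ [].
  - destruct (IH (fun i x Hx => HF i x (or_intror Hx)) S HS) as (S1 & Sub1 & Inf1 & H1).
    destruct (INR_unbounded (2 * r / e)) as [k Hk].
    destruct (interval_pigeonhole (fun i => F i x0) e k He (- r) S1 Inf1) as (S2 & Sub2 & Inf2 & H2).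
    { intros i _; pose proof (HF i x0 (or_introl eq_refl)) as Hb.
      assert (2 * r < INR k * e) by
        (replace (2 * r) with (2 * r / e * e) by (field; lra);
         apply Rmult_lt_compat_r; assumption).
      pose proof (Rle_abs (F i x0)); pose proof (Rle_abs (- F i x0)).
      rewrite Rabs_Ropp in *; lra. }
    exists S2; repeat split; auto.
    intros i j x Hi Hj [<- | Hx]; auto.
Qed.

Definition strictly_increasing (phi : nat -> nat) : Prop :=
  forall k, (phi k < phi (S k))%nat.

Lemma strictly_increasing_ge phi : strictly_increasing phi -> forall k, (k <= phi k)%nat.
Proof. intros H k; induction k as [|k IH]; [lia | specialize (H k); lia]. Qed.

Lemma inv_S_pos k : 0 < / INR (S k).
Proof. apply Rinv_0_lt_compat, lt_0_INR; lia. Qed.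

Lemma inv_S_small e : 0 < e -> exists N, forall k, (N <= k)%nat -> / INR (S k) <= e.
Proof.
  intro He; destruct (INR_unbounded (/ e)) as [N HN]; exists N; intros k Hk.
  rewrite <- (Rinv_inv e); apply Rinv_le_contravar; [now apply Rinv_0_lt_compat|].
  apply Rlt_le, Rlt_le_trans with (INR N); [exact HN | apply le_INR; lia].
Qed.

(** The hypothesis is total boundedness in the uniform distance over [P]. Nested infinite index sets
    with oscillation at most [1 / (k + 1)] are built, and one index is picked from each. The general
    [T] serves both coordinates of points and functions on the ball. *)
Lemma diagonal_extraction (T : Type) (P : T -> Prop) (F : nat -> T -> R) :
  (forall e S, 0 < e -> inf_often S ->
    exists S' : nat -> Prop, (forall i, S' i -> S i) /\ inf_often S' /\
      forall i j t, S' i -> S' j -> P t -> Rabs (F i t - F j t) <= e) ->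
  exists phi f, strictly_increasing phi /\
    forall e, 0 < e -> exists N, forall k t, (N <= k)%nat -> P t -> Rabs (F (phi k) t - f t) <= e.
Proof.
  intro Htb.
  set (refines := fun k (S S' : nat -> Prop) => (forall i, S' i -> S i) /\ inf_often S' /\
      forall i j t, S' i -> S' j -> P t -> Rabs (F i t - F j t) <= / INR (Datatypes.S k)).
  set (next := fun k S => epsilon (inhabits S) (refines k S)).
  set (chain := fix chain k := match k with
                 | O => next O (fun _ => True)
                 | Datatypes.S k' => next (Datatypes.S k') (chain k') end).
  assert (Hnext : forall k S, inf_often S -> refines k S (next k S))
    by (intros k S HS; unfold next; apply epsilon_spec, Htb; [apply inv_S_pos | exact HS]).
  assert (Hinf : forall k, inf_often (chain k)).
  { induction k as [|k IH]; simpl.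
    - apply (Hnext O (fun _ => True)); intro N; now exists N.
    - now apply (Hnext (S k)). }
  assert (Hclose : forall k i j t, chain k i -> chain k j -> P t ->
            Rabs (F i t - F j t) <= / INR (S k)).
  { intros [|k]; [apply (Hnext O (fun _ => True)); intro N; now exists N|].
    apply (Hnext (S k) (chain k)), Hinf. }
  assert (Hsub : forall d k i, chain (d + k)%nat i -> chain k i).
  { induction d as [|d IH]; intros k i Hi; [exact Hi|].
    apply IH; now apply (Hnext (S (d + k)) (chain (d + k)%nat) (Hinf _)). }
  (* The lower bound [N] is later the successor of the previous index, which makes [phi] strictly
     increasing. *)
  set (pick := fun N k => epsilon (inhabits O) (fun i => (N <= i)%nat /\ chain k i)).
  assert (Hpick : forall N k, (N <= pick N k)%nat /\ chain k (pick N k))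
    by (intros N k; unfold pick; apply epsilon_spec, Hinf).
  set (phi := fix phi k := match k with
               | O => pick O O | S k' => pick (S (phi k')) (S k') end).
  assert (Hphi : forall k, chain k (phi k)) by (intros [|k]; apply Hpick).
  assert (Hcauchy : forall k j t, (k <= j)%nat -> P t ->
            Rabs (F (phi j) t - F (phi k) t) <= / INR (S k)).
  { intros k j t Hkj Ht; apply (Hclose k); auto.
    apply (Hsub (j - k)%nat); replace (j - k + k)%nat with j by lia; apply Hphi. }
  set (f := fun t => epsilon (inhabits 0) (fun l => Un_cv (fun k => F (phi k) t) l)).
  assert (Hf : forall t, P t -> Un_cv (fun k => F (phi k) t) (f t)).
  { intros t Ht; unfold f; apply epsilon_spec.
    destruct (R_complete (fun k => F (phi k) t)) as [l Hl]; [|now exists l].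
    intros e He; destruct (inv_S_small (e / 4)) as [N HN]; [lra|].
    exists N; intros i j Hi Hj; unfold Rdist.
    pose proof (Hcauchy N i t Hi Ht); pose proof (Hcauchy N j t Hj Ht).
    specialize (HN N (le_n N)).
    replace (F (phi i) t - F (phi j) t)
      with ((F (phi i) t - F (phi N) t) + - (F (phi j) t - F (phi N) t)) by ring.
    eapply Rle_lt_trans; [apply Rabs_triang|]; rewrite Rabs_Ropp; lra. }
  exists phi, f; split.
  - intro k; destruct (Hpick (S (phi k)) (S k)) as [H _]; exact H.
  - intros e He; destruct (inv_S_small (e / 2)) as [N HN]; [lra|].
    exists N; intros k t Hk Ht.
    destruct (Hf t Ht (e / 2)) as [M HM]; [lra|].
    specialize (HM (max M k) (Nat.le_max_l _ _)); unfold Rdist in HM.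
    pose proof (Hcauchy k (max M k) t (Nat.le_max_r _ _) Ht); specialize (HN k Hk).
    replace (F (phi k) t - f t)
      with (- (F (phi (max M k)) t - F (phi k) t) + (F (phi (max M k)) t - f t)) by ring.
    eapply Rle_trans; [apply Rabs_triang|]; rewrite Rabs_Ropp; lra.
Qed.

Lemma bolzano_weierstrass n r (p : nat -> pt) : (forall k, normRn n (p k) <= r) ->
  exists phi x, strictly_increasing phi /\ inRn n x /\ seq_conv n (fun k => p (phi k)) x.
Proof.
  intro Hp.
  destruct (diagonal_extraction nat (fun i => (i < n)%nat) (fun k i => p k i))
    as (phi & f & Hphi & Hf).
  { intros e S He HS.
    destruct (list_pigeonhole nat (fun k i => p k i) r e (seq 0 n) He) with (S := S)
      as (S' & Hsub & Hinf & HS'); auto.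
    - intros k i Hi; apply in_seq in Hi.
      eapply Rle_trans; [apply (coord_le_norm n); lia | apply Hp].
    - exists S'; repeat split; auto; intros i j t Hi Hj Ht; apply HS'; auto.
      apply in_seq; lia. }
  exists phi, (fun i => if lt_dec i n then f i else 0); split; [exact Hphi|]; split.
  { intros i Hi; destruct (lt_dec i n); [lia | reflexivity]. }
  intros e He; assert (Hn : 0 < INR (S n)) by (apply lt_0_INR; lia).
  assert (Hd : 0 < e / INR (S n)) by now apply Rdiv_lt_0_compat.
  destruct (Hf _ Hd) as [N HN]; exists N; intros k Hk.
  apply Rle_lt_trans with (INR n * (e / INR (S n))).
  - apply norm_le_coord; [lra|]; intros i Hi; unfold psub.
    destruct (lt_dec i n); [now apply HN | lia].
  - replace e with (INR (S n) * (e / INR (S n))) at 2 by (field; lra).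
    apply Rmult_lt_compat_r; [exact Hd | apply lt_INR; lia].
Qed.

(** The Arzelà-Ascoli theorem on the unit ball: oscillation [e / 2] on a finite net, plus two
    Lipschitz errors of at most [e / 4] each. *)
Lemma lip_ball_extraction n r (h : nat -> pt -> R) : 0 <= r -> (forall i, lip_ball n r (h i)) ->
  exists phi f, strictly_increasing phi /\
    forall e, 0 < e -> exists N, forall k y, (N <= k)%nat -> normRn n y <= 1 ->
      Rabs (h (phi k) y - f y) <= e.
Proof.
  intros Hr Hh.
  apply (diagonal_extraction pt (fun y => normRn n y <= 1) h).
  intros e S He HS.
  set (d := e / (4 * (r + 1))).
  assert (Hd : 0 < d) by (apply Rdiv_lt_0_compat; lra).
  assert (Hrd : r * d <= e / 4).
  { replace (e / 4) with ((r + 1) * d) by (unfold d; field; lra).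
    apply Rmult_le_compat_r; lra. }
  destruct (ball_net n d Hd) as (X & HXn & HX).
  destruct (list_pigeonhole pt h r (e / 2) X) with (S := S) as (S' & Hsub & Hinf & HS'); auto.
  - lra.
  - intros i x Hx; apply (Hh i); auto.
  - exists S'; repeat split; auto; intros i j y Hi Hj Hy.
    destruct (HX y Hy) as (x & Hx & Hxy).
    pose proof (HXn x Hx) as Hxn.
    pose proof (HS' i j x Hi Hj Hx) as Hij.
    assert (r * distRn n x y <= r * d) by (apply Rmult_le_compat_l; lra).
    destruct (Hh i) as [_ Li]; destruct (Hh j) as [_ Lj].
    pose proof (Li x y Hxn Hy); pose proof (Li y x Hy Hxn).
    pose proof (Lj x y Hxn Hy); pose proof (Lj y x Hy Hxn).
    rewrite (dist_sym n y x) in *.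
    pose proof (Rle_abs (h i x - h j x)); pose proof (Rle_abs (- (h i x - h j x))).
    rewrite Rabs_Ropp in *; apply Rabs_le; lra.
Qed.

Lemma decreasing_gap (a : nat -> R) : (forall i, a (S i) <= a i) -> (forall i, 0 <= a i) ->
  forall d, 0 < d -> exists N, forall i, (N <= i)%nat -> a i <= a (S i) + d.
Proof.
  intros Hdec Hpos d Hd.
  destruct (decreasing_cv a) as [l Hl]; [exact Hdec | |].
  { exists 0; intros x [i ->]; unfold opp_seq; specialize (Hpos i); lra. }
  destruct (Hl (d / 2)) as [N HN]; [lra|].
  exists N; intros i Hi; pose proof (HN i Hi) as A; pose proof (HN (S i)) as B.
  unfold Rdist in *; specialize (B ltac:(lia)).
  apply Rabs_def2 in A; apply Rabs_def2 in B; lra.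
Qed.

Lemma first_exit (Q : nat -> Prop) d : forall i, ~ Q (i + d)%nat ->
  exists i', (i <= i')%nat /\ ~ Q i' /\ forall k, (i <= k < i')%nat -> Q k.
Proof.
  induction d as [|d IH]; intros i H.
  - exists i; rewrite Nat.add_0_r in H; repeat split; [lia | exact H | intros; lia].
  - destruct (classic (Q i)) as [Qi | Qi].
    + destruct (IH (S i)) as (i' & Hi & Hq & Hk).
      { replace (S i + d)%nat with (i + S d)%nat by lia; exact H. }
      exists i'; repeat split; [lia | exact Hq |].
      intros k Hk'; destruct (Nat.eq_dec k i) as [-> | Hne]; [exact Qi | apply Hk; lia].
    + exists i; repeat split; [lia | exact Qi | intros; lia].
Qed.

(** One label must work for all [d] at once. If every label failed at its own [d] and from its own
    index on, the least of these finitely many [d] and the largest index would contradict the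
    frequency of [G], by monotonicity in [d]. *)
Lemma label_pigeonhole (sigma : nat -> nat) (G : R -> nat -> Prop) m :
  (forall d d' i, d <= d' -> G d i -> G d' i) -> (forall i, (sigma i < m)%nat) ->
  (forall d, 0 < d -> inf_often (G d)) ->
  exists j, (j < m)%nat /\ forall d, 0 < d -> inf_often (fun i => G d i /\ sigma i = j).
Proof.
  intros Hmono Hsigma HG; apply NNPP; intro No.
  enough (E : forall m', (m' <= m)%nat ->
    exists d N, 0 < d /\ forall i, (N <= i)%nat -> (sigma i < m')%nat -> ~ G d i).
  { destruct (E m (le_n m)) as (d & N & Hd & H); destruct (HG d Hd N) as (i & Hi & Gi).
    now apply (H i Hi (Hsigma i)). }
  induction m' as [|m' IH]; intro Hm.
  - exists 1, O; split; [lra | intros; lia].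
  - destruct IH as (d & N & Hd & H); [lia|].
    assert (Hj : exists d' N', 0 < d' /\ forall i, (N' <= i)%nat -> sigma i = m' -> ~ G d' i).
    { apply NNPP; intro No'; apply No; exists m'; split; [lia|].
      intros d' Hd' N'; apply NNPP; intro No''; apply No'; exists d', N'; split; [exact Hd'|].
      intros i Hi Hs Gi; apply No''; now exists i. }
    destruct Hj as (d' & N' & Hd' & H'); exists (Rmin d d'), (max N N').
    split; [now apply Rmin_glb_lt|]; intros i Hi Hs Gi.
    destruct (Nat.eq_dec (sigma i) m') as [E | Hne].
    + apply (H' i); [lia | exact E | apply (Hmono (Rmin d d')); [apply Rmin_r | exact Gi]].
    + apply (H i); [lia | lia | apply (Hmono (Rmin d d')); [apply Rmin_l | exact Gi]].
Qed.

Lemma eventually_recurrent (sigma : nat -> nat) m : (forall i, (sigma i < m)%nat) ->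
  exists N, forall i, (N <= i)%nat -> inf_often (fun k => sigma k = sigma i).
Proof.
  intro Hsigma; apply NNPP; intro No.
  (* If non-recurrent labels kept appearing, one of them would appear infinitely often; the real
     parameter is a dummy here. *)
  destruct (label_pigeonhole sigma (fun _ i => ~ inf_often (fun k => sigma k = sigma i)) m)
    as (j & _ & Hj); auto.
  - intros _ _ N; apply NNPP; intro No'; apply No; exists N; intros i Hi.
    apply NNPP; intro H; apply No'; now exists i.
  - destruct (Hj 1 Rlt_0_1 O) as (i & _ & Hi & Ei); apply Hi; rewrite Ei.
    intro N; destruct (Hj 1 Rlt_0_1 N) as (k & Hk & _ & Ek); now exists k.
Qed.

Definition unif_close (n : nat) (d : R) (h f : pt -> R) : Prop :=
  forall y, normRn n y <= 1 -> h y <= f y + d /\ f y <= h y + d.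

(** One-sided because [midpoint_bound] transports only upper estimates; the other side is recovered
    from the energy. *)
Definition below (n : nat) (d : R) (h f : pt -> R) : Prop :=
  forall y, normRn n y <= 1 -> h y <= f y + d.

Lemma midpoint_process_converges n m r (v : nat -> pt) (sigma : nat -> nat) (h : nat -> pt -> R) :
  0 <= r -> (forall j, (j < m)%nat -> dot n (v j) (v j) = 1) ->
  (forall i, (sigma i < m)%nat) -> (forall i, lip_ball n r (h i)) ->
  (forall i, midpoint_bound n (v (sigma i)) (h i) (h (S i))) ->
  exists f,
    (forall d, 0 < d -> exists N, forall i, (N <= i)%nat -> unif_close n d (h i) f) /\
    (forall j, (j < m)%nat -> inf_often (fun i => sigma i = j) ->
       forall y, normRn n y <= 1 -> f (reflect_hyp n (v j) y) = f y).
Proof.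
  intros Hr Hv Hsigma Hlip Hmid.
  destruct (lip_ball_extraction n r h Hr Hlip) as (phi & f & Hphi & Hf).
  assert (Hu : forall i, dot n (v (sigma i)) (v (sigma i)) = 1) by (intro; apply Hv, Hsigma).
  assert (Hcl : forall d, 0 < d -> inf_often (fun i => unif_close n d (h i) f)).
  { intros d Hd N; destruct (Hf d Hd) as [M HM]; exists (phi (max N M)); split.
    - pose proof (strictly_increasing_ge phi Hphi (max N M)); lia.
    - intros y Hy; specialize (HM (max N M) y (Nat.le_max_r _ _) Hy).
      pose proof (Rle_abs (h (phi (max N M)) y - f y)).
      pose proof (Rle_abs (- (h (phi (max N M)) y - f y))); rewrite Rabs_Ropp in *; lra. }
  assert (Hflip : lip_ball n r f).
  { split.
    - intros x Hx; apply Rle_plus_epsilon; intros d Hd.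
      destruct (Hcl d Hd O) as (i & _ & Hi); specialize (Hi x Hx).
      destruct (Hlip i) as [Hb _]; specialize (Hb x Hx).
      pose proof (Rle_abs (h i x)); pose proof (Rle_abs (- h i x)); rewrite Rabs_Ropp in *.
      apply Rabs_le; lra.
    - intros x y Hx Hy; apply Rle_plus_epsilon; intros d Hd.
      destruct (Hcl (d / 2) ltac:(lra) O) as (i & _ & Hi).
      pose proof (Hi x Hx); pose proof (Hi y Hy).
      destruct (Hlip i) as [_ Hl]; specialize (Hl x y Hx Hy); lra. }
  assert (Hmesh : forall d, 0 < d -> exists e, 0 < e /\ 2 * r * e <= d).
  { intros d Hd; exists (d / (2 * (r + 1))).
    assert (0 < d / (2 * (r + 1))) by (apply Rdiv_lt_0_compat; lra); split; [assumption|].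
    replace d with (2 * (r + 1) * (d / (2 * (r + 1)))) at 2 by (field; lra).
    apply Rmult_le_compat_r; lra. }
  assert (Hdec : forall X i k, in_ball n X -> (i <= k)%nat ->
            energy n r X (h k) <= energy n r X (h i)).
  { intros X i k HX Hik; induction Hik as [|k Hik IH]; [lra|].
    eapply Rle_trans; [|exact IH]; now apply (energy_midpoint_le n r X (v (sigma k))). }
  (* Some later [h k] is close to [f], so its energy is nearly that of [f] or larger, while [Hdec]
     keeps it at most that of [h i]. *)
  assert (Hmin : forall X i, in_ball n X -> energy n r X f <= energy n r X (h i)).
  { intros X i HX; apply Rle_plus_epsilon; intros d Hd.
    set (M := INR (length X) * (2 * (2 * r + 1))).
    assert (HM : 0 <= M) by (apply Rmult_le_pos; [apply pos_INR | lra]).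
    assert (Hd' : 0 < d / (M + 1)) by (apply Rdiv_lt_0_compat; lra).
    destruct (Hcl _ Hd' i) as (k & Hk & Hc).
    pose proof (energy_lipschitz n r X f (h k) (d / (M + 1)) HX Hflip (Hlip k) ltac:(lra)
      (fun y Hy => proj2 (Hc y Hy))) as HE; fold M in HE.
    assert (M * (d / (M + 1)) <= d).
    { replace d with ((M + 1) * (d / (M + 1))) at 2 by (field; lra).
      apply Rmult_le_compat_r; lra. }
    pose proof (Hdec X i k HX Hk); lra. }
  (* The net is fixed before [d], because the constant [M] depends on its length. Mesh error and
     [M d] each take [eta / 2], uniformly in [i]. *)
  assert (Hrigid : forall eta, 0 < eta ->
            exists d, 0 < d /\ forall i, below n d (h i) f -> unif_close n eta (h i) f).
  { intros eta He; destruct (Hmesh (eta / 2)) as (e & He0 & Hre); [lra|].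
    destruct (ball_net n e He0) as [X HX].
    set (M := INR (length X) * (2 * (2 * r + 1)) + 1).
    assert (HM : 1 <= M)
      by (unfold M; assert (0 <= INR (length X) * (2 * (2 * r + 1)))
            by (apply Rmult_le_pos; [apply pos_INR | lra]); lra).
    assert (Hd : 0 < eta / (2 * M)) by (apply Rdiv_lt_0_compat; lra).
    assert (HMd : M * (eta / (2 * M)) = eta / 2) by (field; lra).
    exists (eta / (2 * M)); split; [exact Hd|]; intros i Hi y Hy; split.
    - specialize (Hi y Hy).
      assert (1 * (eta / (2 * M)) <= M * (eta / (2 * M))) by (apply Rmult_le_compat_r; lra); lra.
    - pose proof (energy_rigid n r e X f (h i) (eta / (2 * M)) Hr HX Hflip (Hlip i) ltac:(lra)
        Hi (Hmin X i (proj1 HX)) y Hy) as HE; fold M in HE; lra. }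
  (* The energies decrease and are nonnegative, so their successive drops eventually fall below the
     threshold of [energy_drop_small]. *)
  assert (Hsym : forall eta, 0 < eta -> exists N, forall i, (N <= i)%nat ->
            forall y, normRn n y <= 1 -> Rabs (h i y - h i (reflect_hyp n (v (sigma i)) y)) <= eta).
  { intros eta He; destruct (Hmesh (eta / 2)) as (e & He0 & Hre); [lra|].
    destruct (ball_net n e He0) as [X HX].
    destruct (decreasing_gap (fun i => energy n r X (h i))) with (d := eta / 2 * (eta / 2) / 8)
      as [N HN].
    - intro i; apply Hdec; [exact (proj1 HX) | lia].
    - intro i; apply energy_ge0; [exact (proj1 HX) | apply Hlip].
    - nra.
    - exists N; intros i Hi y Hy.
      apply Rle_trans with (eta / 2 + 2 * r * e); [|lra].
      apply (energy_drop_small n r e X (v (sigma i)) (h i) (h (S i))); auto; lra. }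
  set (fixed := fun j => forall y, normRn n y <= 1 -> f (reflect_hyp n (v j) y) = f y).
  assert (Hstay : forall d i k, (i <= k)%nat -> (forall l, (i <= l < k)%nat -> fixed (sigma l)) ->
            below n d (h i) f -> below n d (h k) f).
  { intros d i k Hik; induction Hik as [|k Hik IH]; intros Hfix Hi; [exact Hi|].
    assert (Hk : below n d (h k) f) by (apply IH; [intros l Hl; apply Hfix; lia | exact Hi]).
    intros y Hy; assert (HRy : normRn n (reflect_hyp n (v (sigma k)) y) <= 1)
      by (rewrite reflect_norm; [exact Hy | apply Hu]).
    pose proof (Hmid k y Hy); pose proof (Hk y Hy); pose proof (Hk _ HRy) as HR.
    rewrite (Hfix k ltac:(lia) y Hy) in HR; lra. }
  assert (Hrec : forall j, inf_often (fun i => sigma i = j) -> fixed j).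
  { intros j0 Hj0; apply NNPP; intro Hnf.
    destruct (label_pigeonhole sigma (fun d i => ~ fixed (sigma i) /\ below n d (h i) f) m)
      as (j & Hjm & Hj); auto.
    - intros d d' i Hdd [Hi Hb]; split; [exact Hi|]; intros y Hy; specialize (Hb y Hy); lra.
    - intros d Hd N; destruct (Hcl d Hd N) as (i & Hi & Hc).
      destruct (Hj0 i) as (k & Hk & Ek).
      (* The non-fixing label [j0] occurs at time [k], so a first non-fixing time [i'] exists, and
         [Hstay] carries the estimate up to it. *)
      destruct (first_exit (fun l => fixed (sigma l)) (k - i) i) as (i' & Hi' & Hq & Hl).
      { replace (i + (k - i))%nat with k by lia; now rewrite Ek. }
      exists i'; split; [lia|]; split; [exact Hq|].
      apply (Hstay d i i' Hi' Hl); intros y Hy; apply (Hc y Hy).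
    - assert (Hjf : fixed j).
      { intros y Hy; apply cond_eq; intros eta He.
        (* Three errors of [eta / 4]: from [f] to [h i] at [y], across the reflection, and back to
           [f] at the mirror image. *)
        destruct (Hrigid (eta / 4)) as (d & Hd & Hrig); [lra|].
        destruct (Hsym (eta / 4)) as (N & HN); [lra|].
        destruct (Hj d Hd N) as (i & Hi & [_ Hb] & Ei).
        assert (HRy : normRn n (reflect_hyp n (v j) y) <= 1)
          by (rewrite reflect_norm; [exact Hy | now apply Hv]).
        specialize (HN i Hi y Hy); rewrite Ei in HN.
        pose proof (Hrig i Hb y Hy); pose proof (Hrig i Hb _ HRy).
        set (a := h i y) in *; set (b := h i (reflect_hyp n (v j) y)) in *.
        pose proof (Rle_abs (a - b)); pose proof (Rle_abs (- (a - b))).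
        rewrite Rabs_Ropp in *; apply Rabs_def1; lra. }
      destruct (Hj 1 Rlt_0_1 O) as (i & _ & [Hn _] & Ei); apply Hn; now rewrite Ei. }
  exists f; split; [|intros j _ Hj; now apply Hrec].
  intros eta He; destruct (Hrigid eta He) as (d & Hd & Hrig).
  destruct (eventually_recurrent sigma m Hsigma) as [N HN].
  destruct (Hcl d Hd N) as (i & Hi & Hc); exists i; intros k Hk; apply Hrig.
  apply (Hstay d i k Hk).
  - intros l Hl; apply Hrec, HN; lia.
  - intros y Hy; apply (Hc y Hy).
Qed.

(** * From support functions to the Hausdorff metric *)

(* Testing [q] against points of the segment from a nearly nearest point [p] towards [q];
   no closedness of [B] is required. *)
Lemma approx_separation n r B x e : 0 <= r -> 0 < e -> convex B -> nonempty B -> bounded_by n r B ->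
  (forall y, normRn n y <= 1 -> dot n x y <= supp n B y + e) ->
  exists p, B p /\ distRn n x p <= 2 * e.
Proof.
  intros Hr He Hconv [p0 Hp0] Hb Hsep; apply NNPP; intro No.
  assert (Hfar : forall p, B p -> 2 * e < distRn n x p)
    by (intros p Hp; apply Rnot_le_lt; intro; apply No; now exists p).
  set (sq := fun p => dot n (psub x p) (psub x p)).
  destruct (completeness (fun s => exists p, B p /\ s = - sq p)) as [l [Hub Hlub]].
  { exists 0; intros s (p & _ & ->); pose proof (dot_self_ge0 n (psub x p)); unfold sq; lra. }
  { now exists (- sq p0), p0. }
  (* Here [- l] is the infimum of the squared distances and [4 r^2] bounds the squared distance
     between points of [B]. Moving from [p] towards [q] by the fraction [t], with [p] minimal up to
     [t^2], leaves a first-order error of at most [e^2 / 2]. *)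
  set (t := Rmin 1 (e * e / (1 + 4 * (r * r)))).
  assert (Hrr : 0 <= r * r) by nra.
  assert (Hee : 0 < e * e) by nra.
  assert (Ht0 : 0 < t) by (apply Rmin_glb_lt; [lra | apply Rdiv_lt_0_compat; lra]).
  assert (Ht1 : t <= 1) by apply Rmin_l.
  assert (Ht : t * (1 + 4 * (r * r)) <= e * e).
  { apply Rle_trans with (e * e / (1 + 4 * (r * r)) * (1 + 4 * (r * r))).
    - apply Rmult_le_compat_r; [lra | apply Rmin_r].
    - right; field; lra. }
  assert (Hp : exists p, B p /\ sq p < - l + t * t).
  { apply NNPP; intro No'; assert (l <= l - t * t) by
      (apply Hlub; intros s (p & Hp & ->);
       assert (~ sq p < - l + t * t) by (intro; apply No'; now exists p); lra); nra. }
  destruct Hp as (p & Hp & Hpl).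
  set (E := psub x p).
  assert (Hq : forall q, B q -> dot n q E <= dot n p E + e * e / 2).
  { intros q Hq.
    assert (Hz : B (padd (pscal (1 - t) p) (pscal t q))) by (apply Hconv; auto; lra).
    assert (Hsq : - l <= sq (padd (pscal (1 - t) p) (pscal t q)))
      by (enough (- sq (padd (pscal (1 - t) p) (pscal t q)) <= l) by lra; apply Hub; eauto).
    assert (Eq : sq (padd (pscal (1 - t) p) (pscal t q))
      = sq p - 2 * t * dot n (psub q p) E + t * t * dot n (psub q p) (psub q p)).
    { unfold sq, E; dot_expand.
      rewrite (dot_comm n q x), (dot_comm n p x), (dot_comm n q p); ring. }
    assert (Hqp : dot n (psub q p) (psub q p) <= 4 * (r * r)).
    { rewrite <- norm_sqr.
      assert (normRn n (psub q p) <= 2 * r).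
      { replace (psub q p) with (padd q (pscal (-1) p))
          by (apply functional_extensionality; intro; unfold padd, pscal, psub; ring).
        pose proof (norm_padd n q (pscal (-1) p)) as HN; rewrite norm_pscal in HN.
        rewrite Rabs_left in HN by lra; pose proof (Hb q Hq); pose proof (Hb p Hp); lra. }
      pose proof (norm_ge0 n (psub q p)); nra. }
    rewrite Eq in Hsq; rewrite dot_psub in Hsq.
    set (z := dot n q E - dot n p E) in *.
    set (s := dot n (psub q p) (psub q p)) in *.
    assert (2 * t * z <= t * (t * (1 + s))) by nra.
    assert (2 * z <= t * (1 + s)) by
      (apply Rmult_le_reg_l with t; [exact Ht0 | lra]).
    assert (t * (1 + s) <= t * (1 + 4 * (r * r))) by (apply Rmult_le_compat_l; lra).
    unfold z in *; lra. }
  set (N := normRn n E).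
  assert (HN : 2 * e < N) by exact (Hfar p Hp).
  assert (HNN : dot n x E - dot n p E = N * N)
    by (unfold N; rewrite norm_sqr, <- dot_psub; reflexivity).
  assert (Hi : 0 < / N) by (apply Rinv_0_lt_compat; lra).
  assert (HiN : / N * N = 1) by (apply Rinv_l; lra).
  (* Testing the hypothesis in this direction gives [N <= e^2 / (2 N) + e <= 3 e / 2], against
     [2 e < N]. *)
  assert (Hunit : normRn n (pscal (/ N) E) <= 1)
    by (rewrite norm_pscal, Rabs_right by lra; fold N; lra).
  specialize (Hsep _ Hunit); rewrite dot_pscal_r in Hsep.
  assert (HS : supp n B (pscal (/ N) E) <= / N * (dot n p E + e * e / 2)).
  { apply (supp_le n r); [now exists p0 | exact Hb |]; intros q Hq'.
    rewrite dot_pscal_r; apply Rmult_le_compat_l; [lra | auto]. }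
  assert (/ N * (N * N) <= / N * (e * e / 2) + e) by (rewrite <- HNN; lra).
  assert (/ N * (N * N) = N) by (rewrite <- Rmult_assoc, HiN; ring).
  assert (/ N * (e * e / 2) <= e / 2).
  { replace (e / 2) with (/ N * N * (e / 2)) by (rewrite HiN; ring).
    rewrite Rmult_assoc; apply Rmult_le_compat_l; nra. }
  lra.
Qed.

Lemma compact_bounded n K : compact_Rn n K -> exists r, 0 <= r /\ bounded_by n r K.
Proof.
  intros [_ Hc]; apply NNPP; intro No.
  assert (Hk : forall k : nat, exists x, K x /\ INR k < normRn n x).
  { intro k; apply NNPP; intro No'; apply No; exists (INR k); split; [apply pos_INR|].
    intros x Hx; apply Rnot_lt_le; intro; apply No'; now exists x. }
  apply choice in Hk; destruct Hk as [p Hp].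
  destruct (Hc p) as (phi & x & Hphi & _ & Hx); [intro k; apply Hp|].
  destruct (Hx 1 Rlt_0_1) as [N HN].
  destruct (INR_unbounded (1 + normRn n x)) as [k Hk].
  set (j := max N k); specialize (HN j (Nat.le_max_l _ _)).
  destruct (Hp (phi j)) as [_ Hlt].
  assert (HT : normRn n (p (phi j)) <= distRn n (p (phi j)) x + normRn n x).
  { unfold distRn; replace (p (phi j)) with (padd (psub (p (phi j)) x) x) at 1;
      [apply norm_padd | apply functional_extensionality; intro; unfold padd, psub; ring]. }
  assert (INR k <= INR (phi j)).
  { apply le_INR; pose proof (strictly_increasing_ge phi Hphi j); lia. }
  lra.
Qed.

(** The Wulff shape of [f]. The clause [inRn] is imposed separately since [dot n] does not see
    coordinates from [n] on. *)
Definition body_of (n : nat) (f : pt -> R) : set_pt :=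
  fun x => inRn n x /\ forall y, normRn n y <= 1 -> dot n x y <= f y.

Lemma seq_conv_dot_le n p x y c : normRn n y <= 1 -> seq_conv n p x ->
  (forall d, 0 < d -> exists N, forall k, (N <= k)%nat -> dot n (p k) y <= c + d) ->
  dot n x y <= c.
Proof.
  intros Hy Hx Hc; apply Rle_plus_epsilon; intros d Hd.
  destruct (Hx (d / 2)) as [N1 H1]; [lra|]; destruct (Hc (d / 2)) as [N2 H2]; [lra|].
  specialize (H1 (max N1 N2) (Nat.le_max_l _ _)); specialize (H2 (max N1 N2) (Nat.le_max_r _ _)).
  pose proof (dot_dist n y x (p (max N1 N2))) as HD.
  rewrite dist_sym in HD; rewrite (dot_comm n y x), (dot_comm n y (p _)) in HD.
  pose proof (dist_ge0 n (p (max N1 N2)) x); pose proof (norm_ge0 n y); nra.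
Qed.

Lemma body_of_norm n r f x : (forall y, normRn n y <= 1 -> f y <= r) -> 0 <= r ->
  body_of n f x -> normRn n x <= r.
Proof.
  intros Hf Hr [_ Hx]; apply Rnot_lt_le; intro Hlt.
  set (N := normRn n x) in *.
  assert (HiN : / N * N = 1) by (apply Rinv_l; lra).
  assert (Hi : 0 < / N) by (apply Rinv_0_lt_compat; lra).
  assert (Hu : normRn n (pscal (/ N) x) <= 1)
    by (rewrite norm_pscal, Rabs_right by lra; fold N; lra).
  pose proof (Hx _ Hu) as H; rewrite dot_pscal_r, <- norm_sqr in H; fold N in H.
  rewrite <- Rmult_assoc, HiN in H; pose proof (Hf _ Hu); lra.
Qed.

Lemma body_of_compact n r f : (forall y, normRn n y <= 1 -> f y <= r) -> 0 <= r ->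
  compact_Rn n (body_of n f).
Proof.
  intros Hf Hr; split; [intros x Hx; apply Hx|].
  intros p Hp; destruct (bolzano_weierstrass n r p) as (phi & x & Hphi & Hxn & Hx).
  { intro k; now apply (body_of_norm n r f). }
  exists phi, x; split; [exact Hphi | split; [split; [exact Hxn|] | exact Hx]].
  intros y Hy; apply (seq_conv_dot_le n _ x y (f y) Hy Hx).
  intros d Hd; exists O; intros k _; destruct (Hp (phi k)) as [_ H]; specialize (H y Hy); lra.
Qed.

Lemma body_of_symmetric n u f : inRn n u -> dot n u u = 1 ->
  (forall y, normRn n y <= 1 -> f (reflect_hyp n u y) = f y) -> symmetric_wrt n u (body_of n f).
Proof.
  intros Hun Hu Hf.
  assert (Himp : forall x, body_of n f x -> body_of n f (reflect_hyp n u x)).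
  { intros x [Hxn Hx]; split; [now apply reflect_inRn|].
    intros y Hy; rewrite reflect_dot, <- (Hf y Hy); apply Hx; now rewrite reflect_norm. }
  intro x; split; [apply Himp|]; intro Hx.
  rewrite <- (reflect_reflect n u x Hu); now apply Himp.
Qed.

(** Produces points of the limit body without first showing that [f] is its support function. *)
Lemma selection_limit n r f (Ks : nat -> set_pt) (p : nat -> pt) :
  (forall i, bounded_by n r (Ks i)) ->
  (forall d, 0 < d -> exists N, forall i, (N <= i)%nat -> unif_close n d (supp n (Ks i)) f) ->
  (forall i, Ks i (p i)) ->
  exists phi x, strictly_increasing phi /\ body_of n f x /\ seq_conv n (fun k => p (phi k)) x.
Proof.
  intros Hb Hf Hp.
  destruct (bolzano_weierstrass n r p) as (phi & x & Hphi & Hxn & Hx);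
    [intro k; now apply (Hb k)|].
  exists phi, x; split; [exact Hphi | split; [split; [exact Hxn|] | exact Hx]].
  intros y Hy; apply (seq_conv_dot_le n _ x y (f y) Hy Hx).
  intros d Hd; destruct (Hf d Hd) as [N HN]; exists N; intros k Hk.
  pose proof (strictly_increasing_ge phi Hphi k).
  destruct (HN (phi k) ltac:(lia) y Hy).
  pose proof (supp_ge n r (Ks (phi k)) (p (phi k)) y (Hb _) (Hp _)); lra.
Qed.

(** A point of the limit body is near [Ks i] directly by separation. For a point of [Ks i],
    separation gives nearby points in all later sets, and a subsequence of these converges into the
    limit body. *)
Lemma supp_conv_hausdorff n r f (Ks : nat -> set_pt) : 0 <= r ->
  (forall i, nonempty (Ks i)) -> (forall i, convex (Ks i)) -> (forall i, bounded_by n r (Ks i)) ->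
  (forall d, 0 < d -> exists N, forall i, (N <= i)%nat -> unif_close n d (supp n (Ks i)) f) ->
  hausdorff_conv n Ks (body_of n f).
Proof.
  intros Hr Hne Hconv Hb Hf e He.
  assert (Hnear : forall i x, (forall y, normRn n y <= 1 -> dot n x y <= supp n (Ks i) y + e / 2) ->
            exists p, Ks i p /\ distRn n x p <= e).
  { intros i x H; replace e with (2 * (e / 2)) by field.
    apply (approx_separation n r); auto; lra. }
  destruct (Hf (e / 4)) as [N HN]; [lra|].
  exists N; intros i Hi; split.
  - intros x Hx.
    (* The selection must be total, so an arbitrary point is taken for [j < N]. *)
    assert (Hsel : forall j, exists p, Ks j p /\ ((N <= j)%nat -> distRn n x p <= e)).
    { intro j; destruct (le_dec N j) as [Hj | Hj].
      - destruct (Hnear j x) as (p & Hp & Hd); [|now exists p].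
        intros y Hy; destruct (HN i Hi y Hy); destruct (HN j Hj y Hy).
        pose proof (supp_ge n r (Ks i) x y (Hb i) Hx); lra.
      - destruct (Hne j) as [p Hp]; exists p; split; [exact Hp | tauto]. }
    apply choice in Hsel; destruct Hsel as [p Hp].
    destruct (selection_limit n r f Ks p Hb Hf) as (phi & z & Hphi & Hz & Hlim);
      [intro j; apply Hp|].
    exists z; split; [exact Hz|]; apply Rle_plus_epsilon; intros d Hd.
    destruct (Hlim d Hd) as [M HM]; specialize (HM (max N M) (Nat.le_max_r _ _)).
    pose proof (strictly_increasing_ge phi Hphi (max N M)).
    destruct (Hp (phi (max N M))) as [_ Hpd]; specialize (Hpd ltac:(lia)).
    pose proof (dist_triangle n x (p (phi (max N M))) z); lra.
  - intros x [_ Hx]; destruct (Hnear i x) as (p & Hp & Hd).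
    + intros y Hy; specialize (Hx y Hy); destruct (HN i Hi y Hy); lra.
    + exists p; split; [exact Hp | now rewrite dist_sym].
Qed.

Theorem theorem5p1 (n m : nat) (v : nat -> pt) (sigma : nat -> nat)
  (hv : forall j, (j < m)%nat -> unit_vec n (v j))
  (hsigma : forall i, (sigma i < m)%nat)
  (K : set_pt) (hK : convex_body n K) :
  exists L : set_pt,
    nonempty L /\ compact_Rn n L /\
    hausdorff_conv n (iter_steiner n (fun i => v (sigma i)) K) L /\
    (forall j, (j < m)%nat ->
       (forall N, exists i, (N <= i)%nat /\ sigma i = j) ->
       symmetric_wrt n (v j) L).
Proof.
  destruct hK as (Hne & Hcomp & Hconv).
  destruct (compact_bounded n K Hcomp) as (r & Hr & Hb).
  assert (Hv : forall j, (j < m)%nat -> dot n (v j) (v j) = 1)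
    by (intros j Hj; now apply unit_vec_dot, hv).
  set (Ks := iter_steiner n (fun i => v (sigma i)) K).
  assert (HKs : forall i, nonempty (Ks i) /\ convex (Ks i) /\ bounded_by n r (Ks i)).
  { induction i as [|i (H1 & H2 & H3)]; [now repeat split|].
    split; [now apply steiner_nonempty|]; split; [now apply steiner_convex|].
    apply steiner_bounded; auto. }
  destruct (midpoint_process_converges n m r v sigma (fun i => supp n (Ks i)))
    as (f & Hf & Hsym); auto.
  - intro i; apply supp_lip; apply HKs.
  - intros i y _; apply (steiner_supp_le n r); auto; apply HKs.
  - assert (Hfr : forall y, normRn n y <= 1 -> f y <= r).
    { intros y Hy; apply Rle_plus_epsilon; intros d Hd; destruct (Hf d Hd) as [N HN].
      destruct (HN N (le_n N) y Hy) as [_ H].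
      destruct (supp_lip n r (Ks N)) as [Hl _]; [apply HKs | apply HKs |].
      pose proof (Hl y Hy); pose proof (Rle_abs (supp n (Ks N) y)); lra. }
    exists (body_of n f); split; [|split; [|split]].
    (* Any cluster point of arbitrarily chosen points of the iterates lies in the limit body. *)
    + destruct (choice (fun i x => Ks i x)) as [p Hp]; [intro i; apply HKs|].
      destruct (selection_limit n r f Ks p) as (_ & x & _ & Hx & _); auto;
        [intro i; apply HKs | now exists x].
    + now apply (body_of_compact n r).
    + apply (supp_conv_hausdorff n r); auto; intro i; apply HKs.
    + intros j Hj Hio; apply body_of_symmetric; [apply hv | apply Hv | apply Hsym]; auto.
Qed.
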